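(* Let $f,g,A,Q_1,Q_2,d$ and the constants $\rho,L_g,\sigma,D_{\max},L$ be as in the context, and let $\{w_k\}$, $\{\alpha_k\}$ be the sequences produced by the excessive gap minimization algorithm described in the context. Then for every $k\ge 1$, $$J(w_k)-D(\alpha_k)\;\le\;\frac{6\,L\,D_{\max}}{\sigma (k+1)(k+2)}\;=\;\frac{6\,D_{\max}}{\sigma (k+1)(k+2)}\left(\frac{\|A\|_{1,2}^2}{\rho}+L_g\right).$$
   Context: Definitions. A convex function $h:\mathbb R^n\to\mathbb R\cup\{\infty\}$ is strongly convex with respect to a norm $\|\cdot\|$ if there is a constant $\rho>0$ such that $h-\frac{\rho}{2}\|\cdot\|^2$ is convex; then $h$ is called $\rho$-strongly convex. A function $h:\mathbb R^n\to\mathbb R\cup\{\infty\}$ that is differentiable on $Q\subseteq\mathbb R^n$ has Lipschitz continuous gradient with respect to a norm $\|\cdot\|$ if there is a constant $L$ with $\|\nabla h(w)-\nabla h(w')\|\le L\|w-w'\|$ for all $w,w'\in Q$; then $h$ is called $L$-l.c.g. Setting. $Q_1$ and $Q_2$ are subsets of Euclidean spaces, $A$ is a linear map from the space containing $Q_1$ to the space containing $Q_2$, with transpose $A^\top$, and $f$, $g$ are convex functions defined on $Q_1$ and $Q_2$ respectively. Assumptions: (a) $Q_2$ is compact; (b) with respect to a certain norm on $Q_1$, $f$ is $\rho$-strongly convex (not necessarily l.c.g.); (c) with respect to a certain norm on $Q_2$, $g$ is convex and $L_g$-l.c.g. (not necessarily strongly convex). The prox-function $d$ is a $\sigma$-strongly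 convex (with respect to the norm on $Q_2$) smooth function with $\min_{\alpha\in Q_2}d(\alpha)=0$, $\alpha_0:=\operatorname{argmin}_{\alpha\in Q_2}d(\alpha)$ and $D_{\max}:=\max_{\alpha\in Q_2}d(\alpha)<\infty$. Primal and dual objectives: $$J(w)=f(w)+\max_{\alpha\in Q_2}\{\langle Aw,\alpha\rangle-g(\alpha)\}\ (w\in Q_1),\qquad D(\alpha)=-g(\alpha)-\max_{w\in Q_1}\{\langle -Aw,\alpha\rangle-f(w)\}\ (\alpha\in Q_2).$$ Mild constraint qualifications are assumed to hold, so that $\inf_{w\in Q_1}J(w)=\sup_{\alpha\in Q_2}D(\alpha)$ and $J(w)\ge D(\alpha)$ for all $w\in Q_1,\alpha\in Q_2$. Constants: $\|A\|_{1,2}:=\max\{\langle Aw,\alpha\rangle:\|w\|=\|\alpha\|=1\}$, and $L$ denotes the l.c.g. modulus of $-D$, namely $L=\|A\|_{1,2}^2/\rho+L_g$. Maps: for $\mu>0$, $w(\alpha):=\operatorname{argmax}_{w\in Q_1}\{\langle -Aw,\alpha\rangle-f(w)\}$ and $\alpha_\mu(w):=\operatorname{argmax}_{\alpha\in Q_2}\{\langle Aw,\alpha\rangle-g(\alpha)-\mu d(\alpha)\}$. Bregman divergence: $\Delta(\bar\alpha,\alpha):=d(\bar\alpha)-d(\alpha)-\langle\nabla d(\alpha),\bar\alpha-\alpha\rangle$. Bregman projection: $V(\alpha,u):=\operatorname{argmin}_{\bar\alpha\in Q_2}\{\Delta(\bar\alpha,\alpha)+\langle u,\bar\alpha-\alpha\rangle\}$.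 Algorithm. Initialize $\mu_1=L/\sigma$, $w_1=w(\alpha_0)$, $\alpha_1=V\big(\alpha_0,-\tfrac1{\mu_1}\nabla D(\alpha_0)\big)$. For $k=1,2,\dots$ set $\tau_k=\frac{2}{k+3}$ and $\hat\alpha=(1-\tau_k)\alpha_k+\tau_k\alpha_{\mu_k}(w_k)$; $w_{k+1}=(1-\tau_k)w_k+\tau_k w(\hat\alpha)$; $\tilde\alpha=V\big(\alpha_{\mu_k}(w_k),\tfrac{-\tau_k}{(1-\tau_k)\mu_k}\nabla D(\hat\alpha)\big)$; $\alpha_{k+1}=(1-\tau_k)\alpha_k+\tau_k\tilde\alpha$; $\mu_{k+1}=(1-\tau_k)\mu_k$.
   Formalization: For non-Euclidean norms, where the claim fails as written, gradient differences are measured in the dual norm, and ρ-strong convexity means h(tx+(1-t)y) ≤ t h(x)+(1-t)h(y) - (ρ/2)t(1-t)‖x-y‖² instead of convexity of h-(ρ/2)‖·‖²; both agree with the text for Euclidean norms. *)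

(* Defs.v *)
From HB Require Import structures.
From mathcomp Require Import all_boot all_order all_algebra.
From mathcomp Require Import all_classical all_reals all_analysis.

Set Implicit Arguments.
Unset Strict Implicit.
Unset Printing Implicit Defensive.

Import Order.TTheory GRing.Theory Num.Theory.
Import numFieldNormedType.Exports.

Local Open Scope classical_set_scope.
Local Open Scope ring_scope.

(* R^n is 'rV[R]_n.  Its library topology and derivatives come from the sup
   norm, which does not matter in finite dimension; the norms of the problem
   are functions N satisfying is_norm. *)

Definition dot (R : realType) (n : nat) (u v : 'rV[R]_n) : R :=
  \sum_(i < n) u 0 i * v 0 i.

Record is_norm (R : realType) (n : nat) (N : 'rV[R]_n -> R) : Prop := IsNorm {
  is_norm_triangle : forall x y, N (x + y) <= N x + N y;
  is_norm_scale : forall (c : R) x, N (c *: x) = `|c| * N x;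
  is_norm_eq0 : forall x, N x = 0 -> x = 0 }.

Definition dual_norm (R : realType) (n : nat) (N : 'rV[R]_n -> R)
    (u : 'rV[R]_n) : R :=
  sup [set dot u x | x in [set x | N x <= 1]].

(* If n = 0 or m = 0 the set is empty and the value is 0. *)
Definition op_norm (R : realType) (n m : nat)
    (N1 : 'rV[R]_n -> R) (N2 : 'rV[R]_m -> R)
    (A : {linear 'rV[R]_n -> 'rV[R]_m}) : R :=
  sup [set x | exists w a, [/\ N1 w = 1, N2 a = 1 & x = dot (A w) a]].

Definition grad (R : realType) (n : nat) (h : 'rV[R]_n -> R) (x : 'rV[R]_n)
    : 'rV[R]_n :=
  \row_(i < n) 'D_(delta_mx 0 i) h x.

(* When N comes from an inner product this says that h - rho/2 N^2 is convex
   on Q.  For other norms the two differ: with the l1 norm on the simplex,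
   h - rho/2 N^2 is convex for every convex h and every rho. *)
Definition strongly_convex (R : realType) (n : nat) (N : 'rV[R]_n -> R)
    (Q : set 'rV[R]_n) (rho : R) (h : 'rV[R]_n -> R) : Prop :=
  0 < rho /\
  forall (t : R) (x y : 'rV[R]_n), 0 <= t <= 1 -> Q x -> Q y ->
    h (t *: x + (1 - t) *: y) <=
      t * h x + (1 - t) * h y - rho / 2 * (t * (1 - t)) * N (x - y) ^+ 2.

(* Differences of gradients are linear forms, hence measured by the dual norm;
   this is the norm itself in the Euclidean case. *)
Definition lcg (R : realType) (n : nat) (N : 'rV[R]_n -> R)
    (Q : set 'rV[R]_n) (L : R) (h : 'rV[R]_n -> R) : Prop :=
  (forall x, Q x -> differentiable h x) /\
  forall x y, Q x -> Q y ->
    dual_norm N (grad h x - grad h y) <= L * N (x - y).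

Definition is_argmax (R : realType) (T : Type) (Q : set T) (F : T -> R)
    (x : T) : Prop :=
  Q x /\ forall y, Q y -> F y <= F x.

Definition is_argmin (R : realType) (T : Type) (Q : set T) (F : T -> R)
    (x : T) : Prop :=
  Q x /\ forall y, Q y -> F x <= F y.

Definition primal_obj (R : realType) (n m : nat)
    (A : {linear 'rV[R]_n -> 'rV[R]_m}) (f : 'rV[R]_n -> R)
    (g : 'rV[R]_m -> R) (Q2 : set 'rV[R]_m) (w : 'rV[R]_n) : R :=
  f w + sup [set dot (A w) a - g a | a in Q2].

(* Defined for every a, so that its gradient at points of Q2 makes sense even
   when Q2 has empty interior. *)
Definition dual_obj (R : realType) (n m : nat)
    (A : {linear 'rV[R]_n -> 'rV[R]_m}) (f : 'rV[R]_n -> R)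
    (g : 'rV[R]_m -> R) (Q1 : set 'rV[R]_n) (a : 'rV[R]_m) : R :=
  - g a - sup [set dot (- A w) a - f w | w in Q1].

Definition lcg_modulus (R : realType) (n m : nat)
    (N1 : 'rV[R]_n -> R) (N2 : 'rV[R]_m -> R)
    (A : {linear 'rV[R]_n -> 'rV[R]_m}) (rho Lg : R) : R :=
  op_norm N1 N2 A ^+ 2 / rho + Lg.

(* w = w(a) *)
Definition is_w_map (R : realType) (n m : nat)
    (A : {linear 'rV[R]_n -> 'rV[R]_m}) (f : 'rV[R]_n -> R)
    (Q1 : set 'rV[R]_n) (a : 'rV[R]_m) (w : 'rV[R]_n) : Prop :=
  is_argmax Q1 (fun w' => dot (- A w') a - f w') w.

(* a = alpha_mu(w) *)
Definition is_alpha_map (R : realType) (n m : nat)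
    (A : {linear 'rV[R]_n -> 'rV[R]_m}) (g : 'rV[R]_m -> R)
    (Q2 : set 'rV[R]_m) (d : 'rV[R]_m -> R) (mu : R)
    (w : 'rV[R]_n) (a : 'rV[R]_m) : Prop :=
  is_argmax Q2 (fun a' => dot (A w) a' - g a' - mu * d a') a.

Definition bregman (R : realType) (m : nat) (d : 'rV[R]_m -> R)
    (b a : 'rV[R]_m) : R :=
  d b - d a - dot (grad d a) (b - a).

(* v = V(a, u) *)
Definition is_bregman_proj (R : realType) (m : nat) (Q2 : set 'rV[R]_m)
    (d : 'rV[R]_m -> R) (a u v : 'rV[R]_m) : Prop :=
  is_argmin Q2 (fun b => bregman d b a + dot u (b - a)) v.

Definition tau (R : realType) (k : nat) : R := 2 / (k + 3)%:R.
Arguments tau : clear implicits.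

(* The sequences start at index 1; their values at 0 are irrelevant.
   amu k = alpha_{mu_k}(w_k), ahat k = \hat\alpha, what k = w(\hat\alpha) and
   atil k = \tilde\alpha are the intermediate points of iteration k.  The
   argmax and argmin are unique, by strong convexity of f and d. *)
Record excessive_gap_run (R : realType) (n m : nat)
    (A : {linear 'rV[R]_n -> 'rV[R]_m}) (f : 'rV[R]_n -> R)
    (g : 'rV[R]_m -> R) (Q1 : set 'rV[R]_n) (Q2 : set 'rV[R]_m)
    (d : 'rV[R]_m -> R) (sigma L : R) (alpha0 : 'rV[R]_m)
    (mu : nat -> R) (w what : nat -> 'rV[R]_n)
    (alpha amu ahat atil : nat -> 'rV[R]_m) : Prop := ExcessiveGapRun {
  run_mu1 : mu 1%N = L / sigma;
  run_w1 : is_w_map A f Q1 alpha0 (w 1%N);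
  run_alpha1 : is_bregman_proj Q2 d alpha0
    (- (mu 1%N)^-1 *: grad (dual_obj A f g Q1) alpha0) (alpha 1%N);
  run_amu : forall k : nat, (1 <= k)%N ->
    is_alpha_map A g Q2 d (mu k) (w k) (amu k);
  run_ahat : forall k : nat, (1 <= k)%N ->
    ahat k = (1 - tau R k) *: alpha k + tau R k *: amu k;
  run_what : forall k : nat, (1 <= k)%N ->
    is_w_map A f Q1 (ahat k) (what k);
  run_w : forall k : nat, (1 <= k)%N ->
    w k.+1 = (1 - tau R k) *: w k + tau R k *: what k;
  run_atil : forall k : nat, (1 <= k)%N ->
    is_bregman_proj Q2 d (amu k)
      (- (tau R k / ((1 - tau R k) * mu k))
         *: grad (dual_obj A f g Q1) (ahat k)) (atil k);
  run_alpha : forall k : nat, (1 <= k)%N ->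
    alpha k.+1 = (1 - tau R k) *: alpha k + tau R k *: atil k;
  run_mu : forall k : nat, (1 <= k)%N ->
    mu k.+1 = (1 - tau R k) * mu k }.

(* Main.v *)
(* Let J_mu(w) = f(w) + max_a (<Aw, a> - g(a) - mu d(a)), so that
   J(w) <= J_mu(w) + mu Dmax.  The iteration keeps the excessive gap condition
   J_(mu_k)(w_k) <= D(alpha_k), hence J(w_k) - D(alpha_k) <= mu_k Dmax, and
   mu_k = 6 L / (sigma (k + 1) (k + 2)) by telescoping.  At the first step and at
   each further one, J_mu is bounded above by a linearization of D minus mu
   times a Bregman divergence; the Bregman projection maximizes this bound, and
   strong convexity of d turns its value into the quadratic lower model of D,
   because tau_k^2 L <= (1 - tau_k) mu_k sigma.  The quadratic model is valid
   at every point where the inner maximum over Q1 is attained, which also gives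
   the gradient of D there. *)

Require Import Defs.
From HB Require Import structures.
From mathcomp Require Import all_boot all_order all_algebra.
From mathcomp Require Import all_classical all_reals all_analysis.
From mathcomp Require Import ring lra.

Set Implicit Arguments.
Unset Strict Implicit.
Unset Printing Implicit Defensive.

Import Order.TTheory GRing.Theory Num.Theory.
Import numFieldNormedType.Exports.

Local Open Scope classical_set_scope.
Local Open Scope ring_scope.

(** * The inner product in coordinates *)

Section Dot.
Context {R : realType} {n : nat}.
Implicit Types (u v w : 'rV[R]_n) (c : R).

Lemma dotDl u v w : dot (u + v) w = dot u w + dot v w.
Proof. by rewrite /dot -big_split; apply: eq_bigr => i _; rewrite mxE mulrDl. Qed.

Lemma dotZl c u v : dot (c *: u) v = c * dot u v.
Proof. by rewrite /dot mulr_sumr; apply: eq_bigr => i _; rewrite mxE mulrA. Qed.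

Lemma dotC u v : dot u v = dot v u.
Proof. by apply: eq_bigr => i _; rewrite mulrC. Qed.

Lemma dotDr u v w : dot u (v + w) = dot u v + dot u w.
Proof. by rewrite !(dotC u) dotDl. Qed.

Lemma dotZr c u v : dot u (c *: v) = c * dot u v.
Proof. by rewrite !(dotC u) dotZl. Qed.

Lemma dotNl u v : dot (- u) v = - dot u v.
Proof. by rewrite -scaleN1r dotZl mulN1r. Qed.

Lemma dotNr u v : dot u (- v) = - dot u v.
Proof. by rewrite !(dotC u) dotNl. Qed.

Lemma dotBl u v w : dot (u - v) w = dot u w - dot v w.
Proof. by rewrite dotDl dotNl. Qed.

Lemma dotBr u v w : dot u (v - w) = dot u v - dot u w.
Proof. by rewrite dotDr dotNr. Qed.

Definition dotE := (dotDl, dotDr, dotNl, dotNr, dotZl, dotZr).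

Lemma dot_delta u i : dot u 'e_i = u 0 i.
Proof.
rewrite /dot (bigD1 i) //= big1 => [|j /negPf jNi]; rewrite !mxE ?eqxx ?jNi.
  by rewrite mulr1 addr0.
by rewrite andbF mulr0.
Qed.

Lemma le_coord_norm u i : `|u 0 i| <= `|u|.
Proof.
rewrite [leRHS]mx_normrE.
by apply: (@le_bigmax_cond _ _ _ _ (0, i) xpredT (fun ij => `|u ij.1 ij.2|)).
Qed.

Lemma le_dot_norm u v : `|dot u v| <= (n%:R * `|u|) * `|v|.
Proof.
apply: le_trans (ler_norm_sum _ _ _) _.
rewrite -mulrA mulr_natl -[X in _ *+ X]card_ord -sumr_const.
by apply: ler_sum => i _; rewrite normrM ler_pM ?le_coord_norm.
Qed.

End Dot.

(** * Equivalence of norms and pairing inequalities *)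

Section Norms.
Context {R : realType}.

Lemma is_norm0 n (N : 'rV[R]_n -> R) : is_norm N -> N 0 = 0.
Proof. by move=> hN; rewrite -[X in N X](scale0r 0) is_norm_scale// normr0 mul0r. Qed.

Lemma is_normN n (N : 'rV[R]_n -> R) x : is_norm N -> N (- x) = N x.
Proof. by move=> hN; rewrite -scaleN1r is_norm_scale// normrN1 mul1r. Qed.

Lemma is_norm_ge0 n (N : 'rV[R]_n -> R) x : is_norm N -> 0 <= N x.
Proof.
move=> hN; have := is_norm_triangle hN x (- x).
by rewrite subrr (is_norm0 hN) is_normN// -mulr2n pmulrn_lge0.
Qed.

Lemma le_is_norm_norm n (N : 'rV[R]_n -> R) : is_norm N ->
  exists2 c, 0 <= c & forall x, N x <= c * `|x|.
Proof.
move=> hN; exists (\sum_(i < n) N 'e_i).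
  by apply: sumr_ge0 => i _; exact: is_norm_ge0.
move=> x; rewrite {1}(row_sum_delta x) mulr_suml.
have le_sum (s : seq 'I_n) :
    N (\sum_(i <- s) x 0 i *: 'e_i) <= \sum_(i <- s) N 'e_i * `|x|.
  elim: s => [|i s ih]; first by rewrite !big_nil is_norm0.
  rewrite !big_cons (le_trans (is_norm_triangle hN _ _))// lerD//.
  by rewrite is_norm_scale// mulrC ler_wpM2l ?is_norm_ge0 ?le_coord_norm.
exact: le_sum.
Qed.

Lemma is_norm_continuous n (N : 'rV[R]_n -> R) : is_norm N -> continuous N.
Proof.
move=> hN x; have [c c0 Nc] := le_is_norm_norm hN.
have lip y : `|N x - N y| <= c * `|x - y|.
  rewrite (le_trans _ (Nc _))// ler_norml; apply/andP; split.
    rewrite lerNl opprB lerBlDr -{1}(subrK x y) -(is_normN (x - y))// opprB.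
    exact: is_norm_triangle.
  by rewrite lerBlDr -{1}(subrK y x); exact: is_norm_triangle.
apply/(@cvgrPdist_lt _ _ _ (nbhs x) (nbhs_filter x)) => e e0.
(* The constant [c] may be 0, so [c + 1] serves as the divisor. *)
have ec0 : 0 < e / (c + 1) by rewrite divr_gt0 ?ltr_wpDl.
have := @cvgr_dist_lt _ _ _ (nbhs x) (nbhs_filter x) id x cvg_id _ ec0.
apply: filterS => y; rewrite ltr_pdivlMr ?ltr_wpDl// mulrC => xy.
by rewrite (le_lt_trans (lip y))// (le_lt_trans _ xy)// ler_wpM2r// lerDl.
Qed.

(** By continuity [N] attains a minimum on the compact unit sphere; definiteness makes it positive,
    and its inverse is the constant. *)
Lemma norm_le_is_norm n (N : 'rV[R]_n -> R) : is_norm N ->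
  exists2 c, 0 <= c & forall x, `|x| <= c * N x.
Proof.
move=> hN; pose S := [set x : 'rV[R]_n | `|x| = 1].
have unitS (x : 'rV[R]_n) : x != 0 -> S (`|x|^-1 *: x).
  by move=> x0; rewrite /S/= normrZ normfV normr_id mulVf// normr_eq0.
(* When the sphere is empty ([n = 0]), every vector is 0. *)
have [S0|/set0P/negP/negPn/eqP S0] := pselect (S !=set0); last first.
  exists 0 => // x; rewrite mul0r normr_le0.
  by apply/negPn/negP => /unitS; rewrite S0.
have cS : compact S.
  apply: bounded_closed_compact.
    by exists 1; split=> // t t1 x /= ->; exact: ltW.
  apply: (@closed_comp _ _ (fun x : 'rV[R]_n => `|x|) [set 1]) => [x _|].
    exact: norm_continuous.
  exact: closed_eq.
have cN : {within S, continuous N}.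
  by apply: continuous_subspaceT; exact: is_norm_continuous.
have [a aS Na] := EVT_min_rV S0 cS cN.
move: aS; rewrite inE => a1.
have Na0 : 0 < N a.
  rewrite lt_def is_norm_ge0// andbT; apply/eqP => /(is_norm_eq0 hN) a0.
  by move: a1; rewrite /S /= a0 normr0 => /esym/eqP; rewrite oner_eq0.
exists (N a)^-1 => [|x]; first by rewrite invr_ge0 ltW.
have [->|x0] := eqVneq x 0; first by rewrite normr0 (is_norm0 hN) mulr0.
rewrite mulrC ler_pdivlMr//.
have /Na : `|x|^-1 *: x \in S by rewrite inE; exact: unitS.
rewrite is_norm_scale// normfV normr_id.
by rewrite mulrC ler_pdivlMr ?normr_gt0// mulrC.
Qed.

(** Homogeneity reduces to [N x = 1]. For [sup] to be an upper bound the set must be bounded, which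
    norm equivalence provides. *)
Lemma dot_le_dual_norm n (N : 'rV[R]_n -> R) u x : is_norm N ->
  dot u x <= dual_norm N u * N x.
Proof.
move=> hN; have [c c0 Nc] := norm_le_is_norm hN.
have [->|x0] := eqVneq x 0.
  by rewrite (is_norm0 hN) mulr0 -[X in dot u X](scale0r 0) dotZr mul0r.
have Nx0 : 0 < N x.
  rewrite lt_def is_norm_ge0// andbT; apply: contra x0 => /eqP.
  by move=> /(is_norm_eq0 hN) ->.
rewrite -ler_pdivrMr// mulrC -dotZr; apply: ub_le_sup.
  exists (n%:R * `|u| * c) => _ [y /= Ny <-].
  rewrite (le_trans (ler_norm _))// (le_trans (le_dot_norm _ _))//.
  rewrite ler_wpM2l ?mulr_ge0// (le_trans (Nc y))//.
  by rewrite -{2}[c]mulr1 ler_wpM2l.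
exists ((N x)^-1 *: x) => //=.
by rewrite is_norm_scale// normfV gtr0_norm// mulVf// gt_eqF.
Qed.

Lemma linear_bounded n m (A : {linear 'rV[R]_n -> 'rV[R]_m}) :
  exists2 c, 0 <= c & forall x, `|A x| <= c * `|x|.
Proof.
exists (\sum_(i < n) `|A 'e_i|); first by apply: sumr_ge0.
move=> x; rewrite {1}(row_sum_delta x) linear_sum mulr_suml.
rewrite (le_trans (ler_norm_sum _ _ _))// ler_sum// => i _.
by rewrite linearZ normrZ mulrC ler_wpM2l ?le_coord_norm.
Qed.

Lemma dot_le_op_norm n m (N1 : 'rV[R]_n -> R) (N2 : 'rV[R]_m -> R)
    (A : {linear 'rV[R]_n -> 'rV[R]_m}) w a : is_norm N1 -> is_norm N2 ->
  dot (A w) a <= op_norm N1 N2 A * N1 w * N2 a.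
Proof.
move=> hN1 hN2.
(* [op_norm] ranges over unit vectors only, so vectors that cannot be normalized are treated
   first. *)
have [w0|w0] := eqVneq (N1 w) 0.
  rewrite w0 mulr0 mul0r (is_norm_eq0 hN1 w0) linear0.
  by rewrite -[X in dot X a](scale0r 0) dotZl mul0r.
have [a0|a0] := eqVneq (N2 a) 0.
  rewrite a0 mulr0 (is_norm_eq0 hN2 a0).
  by rewrite -[X in dot _ X](scale0r 0) dotZr mul0r.
have w1 : 0 < N1 w by rewrite lt_def w0 is_norm_ge0.
have a1 : 0 < N2 a by rewrite lt_def a0 is_norm_ge0.
have [c1 c10 Nc1] := norm_le_is_norm hN1.
have [c2 c20 Nc2] := norm_le_is_norm hN2.
have [c c0 Ac] := linear_bounded A.
rewrite -!ler_pdivrMr// (_ : _ / _ / _ =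
    dot (A ((N1 w)^-1 *: w)) ((N2 a)^-1 *: a)); last first.
  by rewrite linearZ dotZl dotZr mulrC (mulrC (dot _ _)).
apply: ub_le_sup.
  exists (m%:R * (c * c1) * c2) => _ [v [b [v1 b1 ->]]].
  rewrite (le_trans (ler_norm _))// (le_trans (le_dot_norm _ _))//.
  rewrite ler_pM ?mulr_ge0//; last by rewrite (le_trans (Nc2 b))// b1 mulr1.
  rewrite ler_wpM2l// (le_trans (Ac v))// ler_wpM2l// (le_trans (Nc1 v))//.
  by rewrite v1 mulr1.
exists ((N1 w)^-1 *: w), ((N2 a)^-1 *: a).
by split=> //; rewrite is_norm_scale// normfV gtr0_norm// mulVf.
Qed.

End Norms.

(** * First-order inequalities on convex sets *)

Section Gradient.
Context {R : realType} {n : nat}.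
Implicit Types (h : 'rV[R]_n -> R) (x y v : 'rV[R]_n).

Lemma derive_dot_grad h x v : differentiable h x -> 'D_v h x = dot (grad h x) v.
Proof.
move=> dh; rewrite deriveE// {1}(row_sum_delta v) linear_sum /dot.
by apply: eq_bigr => i _; rewrite linearZ mxE deriveE// /GRing.scale /= mulrC.
Qed.

(** The limit is taken from the right because, for [v = y - x] in a convex set, only the points with
    [t] in [[0, 1]] are known to stay in the set. *)
Lemma cvg_grad h x v : differentiable h x ->
  t^-1 * (h (x + t *: v) - h x) @[t --> 0^'+] --> dot (grad h x) v.
Proof.
move=> dh; rewrite -derive_dot_grad//; apply: cvg_dnbhs_at_right.
under eq_fun do rewrite [x + _]addrC.
exact: (@diff_derivable _ _ _ _ _ v dh).
Qed.

(** Dividing by [t] and letting [t] tend to 0 removes the remainder [e], which accommodates the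
    [t * (1 - t)] of strong convexity. *)
Lemma dot_grad_le h x v c e : differentiable h x ->
  (forall t, 0 < t <= 1 -> h (x + t *: v) <= h x + t * c + t ^+ 2 * e) ->
  dot (grad h x) v <= c.
Proof.
move=> dh hv; have ce : c + t * e @[t --> 0^'+] --> c.
  have te : id t * cst e t @[t --> (0 : R)^'+] --> 0 * e.
    by apply: cvgM; [apply: cvg_at_right_filter; exact: cvg_id | exact: cvg_cst].
  have := cvgD (@cvg_cst _ c _ (0 : R)^'+ _) te; rewrite mul0r addr0; exact.
apply: (ler_cvg_to (cvg_grad dh) ce); near=> t.
have t0 : 0 < t by near: t; exact: nbhs_right_gt.
rewrite mulrC ler_pdivrMr// lerBlDl (le_trans (hv t _))//.
  by rewrite t0; near: t; exact: nbhs_right_le.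
by rewrite le_eqVlt; apply/orP; left; apply/eqP; ring.
Unshelve. all: by end_near. Qed.

Lemma le_dot_grad h x v c : differentiable h x ->
  (forall t, 0 < t <= 1 -> h x + t * c <= h (x + t *: v)) ->
  c <= dot (grad h x) v.
Proof.
move=> dh hv; apply: (ler_cvg_to (cvg_cst c) (cvg_grad dh)); near=> t.
have t0 : 0 < t by near: t; exact: nbhs_right_gt.
rewrite [leRHS]mulrC ler_pdivlMr// lerBrDl mulrC hv// t0.
by near: t; exact: nbhs_right_le.
Unshelve. all: by end_near. Qed.

Lemma convex_setP (Q : set 'rV[R]_n) x y t : convex_set Q -> Q x -> Q y ->
  0 <= t <= 1 -> Q (t *: x + (1 - t) *: y).
Proof.
move=> cQ Qx Qy t01.
by have := cQ x y (Itv01 (proj1 (andP t01)) (proj2 (andP t01)));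
  rewrite !inE; apply.
Qed.

Lemma convex_set_segment (Q : set 'rV[R]_n) x y t : convex_set Q -> Q x -> Q y ->
  0 <= t <= 1 -> Q (x + t *: (y - x)).
Proof.
move=> cQ Qx Qy t01; have := convex_setP cQ Qy Qx t01.
by rewrite scalerBr scalerBl scale1r addrCA.
Qed.

Lemma convex_functionP (Q : set 'rV[R]_n) h x y t : convex_function Q h ->
  Q x -> Q y -> 0 <= t <= 1 ->
  h (t *: x + (1 - t) *: y) <= t * h x + (1 - t) * h y.
Proof.
move=> ch Qx Qy t01.
have := ch (Itv01 (proj1 (andP t01)) (proj2 (andP t01))) x y.
by rewrite !inE; apply.
Qed.

Lemma convex_function_segment (Q : set 'rV[R]_n) h x y t :
  convex_function Q h -> Q x -> Q y -> 0 <= t <= 1 ->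
  h (x + t *: (y - x)) <= h x + t * (h y - h x).
Proof.
move=> ch Qx Qy t01; have := convex_functionP ch Qy Qx t01.
rewrite scalerBr scalerBl scale1r [_ - t *: x]addrC addrA addrC => /le_trans; apply.
by rewrite le_eqVlt; apply/orP; left; apply/eqP; ring.
Qed.

Lemma convex_ge_tangent (Q : set 'rV[R]_n) h x y : convex_function Q h ->
  Q x -> Q y -> differentiable h x -> h x + dot (grad h x) (y - x) <= h y.
Proof.
move=> ch Qx Qy dh; rewrite -lerBrDl.
apply: (@dot_grad_le _ _ _ _ 0) => // t /andP[t0 t1].
rewrite mulr0 addr0; apply: convex_function_segment ch _ _ _ => //.
by rewrite ltW.
Qed.

Lemma strongly_convex_bregman N (Q : set 'rV[R]_n) s h x y :
  strongly_convex N Q s h -> Q x -> Q y -> differentiable h x ->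
  s / 2 * N (y - x) ^+ 2 <= bregman h y x.
Proof.
move=> [_ sh] Qx Qy dh; rewrite /bregman lerBrDl -lerBrDr.
apply: (@dot_grad_le _ _ _ _ (s / 2 * N (y - x) ^+ 2)) => // t /andP[t0 t1].
have t01 : 0 <= t <= 1 by rewrite ltW.
have := sh t y x t01 Qy Qx.
rewrite (_ : t *: y + _ = x + t *: (y - x)); last first.
  by rewrite scalerBr scalerBl scale1r [RHS]addrC addrA addrAC.
move/le_trans; apply.
by rewrite le_eqVlt; apply/orP; left; apply/eqP; field.
Qed.

Lemma argmin_dot_grad_ge0 (Q : set 'rV[R]_n) h x y : convex_set Q ->
  is_argmin Q h x -> Q y -> differentiable h x ->
  0 <= dot (grad h x) (y - x).
Proof.
move=> cQ [Qx hx] Qy dh; apply: le_dot_grad => // t /andP[t0 t1].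
by rewrite mulr0 addr0 hx//; apply: convex_set_segment => //; rewrite ltW.
Qed.

Lemma is_derive_line h x v (s : R) : differentiable h (x + s *: v) ->
  is_derive s 1 (fun t => h (x + t *: v)) (dot (grad h (x + s *: v)) v).
Proof.
move=> dh; rewrite -derive_dot_grad//.
have E : (fun t : R => t^-1 *: (((fun t => h (x + t *: v)) \o shift s) (t *: 1) -
       h (x + s *: v))) =
    (fun t => t^-1 *: ((h \o shift (x + s *: v)) (t *: v) - h (x + s *: v))).
  apply/funext => t /=; congr (_ *: (h _ - _)).
  by rewrite [t *: 1]mulr1 scalerDl addrCA.
apply: DeriveDef; first by rewrite /derivable E; exact: diff_derivable.
by rewrite /derive E.
Qed.

(** The descent lemma, without integration: [p] is [h] along the segment minus the linear and
    quadratic terms of its model. The Lipschitz bound paired with [v] gives a nonpositive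
    derivative, so [p 1 <= p 0]. *)
Lemma lcg_le_quadratic N (Q : set 'rV[R]_n) L h x y :
  is_norm N -> convex_set Q -> lcg N Q L h -> Q x -> Q y ->
  h y <= h x + dot (grad h x) (y - x) + L / 2 * N (y - x) ^+ 2.
Proof.
move=> hN cQ [dh lh] Qx Qy; set v := y - x.
pose p (t : R) := h (x + t *: v) - (t * dot (grad h x) v + t ^+ 2 * (L / 2 * N v ^+ 2)).
have Qt (t : R) : 0 <= t <= 1 -> Q (x + t *: v) by exact: convex_set_segment.
have dp (t : R) : 0 <= t <= 1 -> is_derive t 1 p
    (dot (grad h (x + t *: v)) v - (dot (grad h x) v + t * (L * N v ^+ 2))).
  move=> t01; have ? := is_derive_line (dh _ (Qt _ t01)).
  apply: is_derive_eq.
  by rewrite /GRing.scale /=; field.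
have : p 1 <= p 0.
  apply: (@ler0_derive1_nincr _ p 0 1) => //.
  - move=> t; rewrite in_itv/= => /andP[t0 t1].
    by have [] := dp t _; rewrite ?ltW.
  - move=> t; rewrite in_itv/= => /andP[t0 t1].
    have t01 : 0 <= t <= 1 by rewrite !ltW.
    rewrite derive1E; have [_ ->] := dp t t01.
    rewrite opprD addrA -dotBl subr_le0 (le_trans (dot_le_dual_norm _ _ hN))//.
    have := lh _ _ (Qt _ t01) Qx; rewrite [x + _ - x]addrC addKr is_norm_scale//.
    rewrite ger0_norm ?(ltW t0)// => lht.
    rewrite (le_trans (ler_wpM2r (is_norm_ge0 _ hN) lht))//.
    by rewrite le_eqVlt; apply/orP; left; apply/eqP; ring.
  - apply: derivable_within_continuous => t; rewrite in_itv/= => t01.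
    by have [] := dp t t01.
rewrite /p scale1r scale0r addr0 /v [x + (y - x)]addrC subrK.
by rewrite expr1n expr0n /= !mul1r !mul0r addr0 subr0 lerBlDr addrA.
Qed.

End Gradient.

(** The difference quotient is within [c * |t|] of [l]. Only the direction [v] is involved, so this
    suits functions not known to be differentiable, such as the dual objective. *)
Lemma is_derive_quadratic (R : realType) n (h : 'rV[R]_n -> R) x v l c : 0 <= c ->
  (forall t, `|h (t *: v + x) - h x - t * l| <= c * t ^+ 2) -> is_derive x v h l.
Proof.
move=> c0 hq.
suff cv : t^-1 *: (h (t *: v + x) - h x) @[t --> (0 : R)^'] --> l.
  by apply: DeriveDef; [apply/cvg_ex; exists l | exact: cvg_lim cv].
apply/cvgrPdist_le => e e0; near=> t.
have t0 : t != 0 by near: t; exact: nbhs_dnbhs_neq.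
rewrite distrC (_ : _ *: _ - l = t^-1 * (h (t *: v + x) - h x - t * l)); last first.
  by rewrite mulrBr mulKf.
rewrite normrM normfV mulrC ler_pdivrMr ?normr_gt0// (le_trans (hq t))//.
rewrite -(real_normK (num_real t)) expr2 mulrA ler_wpM2r// (@le_trans _ _ ((c + 1) * `|t|))//.
  by rewrite ler_wpM2r// lerDl.
rewrite mulrC -ler_pdivlMr ?ltr_wpDl//.
near: t; apply: dnbhs0_le => //; by rewrite divr_gt0 ?ltr_wpDl.
Unshelve. all: by end_near. Qed.

(** * Gradient and quadratic bounds of the dual objective *)

Section DualObjective.
Context {R : realType} {n m : nat}.
Variables (N1 : 'rV[R]_n -> R) (N2 : 'rV[R]_m -> R).
Variables (A : {linear 'rV[R]_n -> 'rV[R]_m}) (f : 'rV[R]_n -> R).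
Variables (g : 'rV[R]_m -> R) (Q1 : set 'rV[R]_n) (rho : R).
Hypotheses (hN1 : is_norm N1) (hN2 : is_norm N2) (cQ1 : convex_set Q1).
Hypothesis hf : strongly_convex N1 Q1 rho f.
Implicit Types (a b : 'rV[R]_m) (v w : 'rV[R]_n).

Local Notation K := (op_norm N1 N2 A ^+ 2 / (2 * rho)).
Local Notation D := (dual_obj A f g Q1).

(** Comparing [w] with the points of the segment towards [v] and dividing by [t] gives
    [(1 - t) * E <= Fw - Fv]; then [t] tends to 0. *)
Lemma w_map_quadratic_growth a w v : is_w_map A f Q1 a w -> Q1 v ->
  dot (- A v) a - f v + rho / 2 * N1 (v - w) ^+ 2 <= dot (- A w) a - f w.
Proof.
move=> [Qw wmax] Qv; have [_ sf] := hf.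
set E := rho / 2 * _; set Fv := _ - f v; set Fw := _ - f w.
have Et t : 0 < t <= 1 -> (1 - t) * E <= Fw - Fv.
  move=> /andP[t0 t1]; have t01 : 0 <= t <= 1 by rewrite ltW.
  have := wmax _ (convex_setP cQ1 Qv Qw t01).
  rewrite linearD !linearZ /= !dotE => h.
  by move: (sf t v w t01 Qv Qw) => sftv; rewrite -(ler_pM2l t0) /Fw /Fv !dotNl /E; lra.
rewrite -lerBrDl; case: (leP E (Fw - Fv)) => // FE.
have F0 := Et 1; rewrite subrr mul0r ltr01 lexx in F0; have {}F0 := F0 isT.
have E0 : 0 < E by exact: le_lt_trans FE.
(* For this [t], [(1 - t) * E] is the midpoint of [E] and [Fw - Fv], hence exceeds [Fw - Fv] if [E]
   does. *)
have t01 : 0 < (E - (Fw - Fv)) / (2 * E) <= 1.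
  apply/andP; split; first by apply: divr_gt0; lra.
  by rewrite ler_pdivrMr; lra.
have := Et _ t01; rewrite (_ : (1 - _) * E = E - (E - (Fw - Fv)) / 2); first lra.
by field; rewrite gt_eqF.
Qed.

(* [<A (w - v), b - a> <= ||A|| r s <= rho/2 r^2 + ||A||^2/(2 rho) s^2] with
   [r = N1 (v - w)] and [s = N2 (b - a)]; the growth of the inner problem
   absorbs the first term. *)
Lemma w_map_perturb a b w v : is_w_map A f Q1 a w -> Q1 v ->
  dot (- A v) b - f v <= dot (- A w) b - f w + K * N2 (b - a) ^+ 2.
Proof.
move=> aw Qv; have growth := w_map_quadratic_growth aw Qv.
have rho0 : 0 < rho by case: hf.
have opA := dot_le_op_norm A (w - v) (b - a) hN1 hN2.
have r_sym : N1 (w - v) = N1 (v - w) by rewrite -(is_normN _ hN1) opprB.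
move: opA growth; rewrite linearB r_sym !dotE.
set r := N1 _; set s := N2 _; set o := op_norm _ _ _ => opA growth.
have young : o * r * s <= rho / 2 * r ^+ 2 + o ^+ 2 / (2 * rho) * s ^+ 2.
  rewrite -subr_ge0 (_ : _ - _ = (rho * r - o * s) ^+ 2 / (2 * rho)).
    by rewrite divr_ge0 ?sqr_ge0// mulr_ge0// ltW.
  by field; rewrite gt_eqF.
lra.
Qed.

Section AtPoint.
Variables (a : 'rV[R]_m) (w : 'rV[R]_n).
Hypothesis aw : is_w_map A f Q1 a w.

(** Attainment at the single point [a] suffices: [w_map_perturb] bounds the inner objective at every
    [b], so the [sup] is a true supremum there. *)
Lemma dual_obj_le b v : Q1 v -> D b <= f v + dot (A v) b - g b.
Proof.
move=> Qv; rewrite /dual_obj; set S := [set _ | _ in _].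
have : dot (- A v) b - f v <= sup S.
  apply: ub_le_sup; last by exists v.
  exists (dot (- A w) b - f w + K * N2 (b - a) ^+ 2) => _ [u Qu <-].
  exact: w_map_perturb.
rewrite dotNl; lra.
Qed.

Lemma dual_obj_ge b :
  f w + dot (A w) b - g b - K * N2 (b - a) ^+ 2 <= D b.
Proof.
rewrite /dual_obj; set S := [set _ | _ in _].
have : sup S <= dot (- A w) b - f w + K * N2 (b - a) ^+ 2.
  apply: ge_sup; first by exists (dot (- A w) b - f w), w => //; case: aw.
  by move=> _ [u Qu <-]; exact: w_map_perturb.
rewrite dotNl; lra.
Qed.

Lemma dual_obj_w_map : D a = f w + dot (A w) a - g a.
Proof.
apply/eqP; rewrite eq_le dual_obj_le; last by case: aw.
by have := dual_obj_ge a; rewrite subrr (is_norm0 hN2) expr0n mulr0 subr0.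
Qed.

(** A form of Danskin's theorem: [D + g] lies below an affine function with slope [A w], touches it
    at [a], and differs from it by at most [K * N2 (b - a) ^+ 2]. *)
Lemma grad_dual_obj : differentiable g a -> grad D a = A w - grad g a.
Proof.
move=> dg; apply/rowP => i; rewrite !mxE; set v := delta_mx 0 i.
have rho0 : 0 < rho by case: hf.
have dDg : is_derive a v (fun b => D b + g b) ((A w) 0 i).
  apply: (@is_derive_quadratic _ _ _ _ _ _ (K * N2 v ^+ 2)) => [|t].
    by rewrite mulr_ge0 ?sqr_ge0// divr_ge0 ?sqr_ge0// mulr_ge0// ltW.
  have := dual_obj_ge (t *: v + a); have := dual_obj_le (t *: v + a) (proj1 aw).
  rewrite dual_obj_w_map addrK !dotDr dotZr dot_delta is_norm_scale// exprMn.
  rewrite real_normK ?num_real// => le_D ge_D; rewrite ler_norml.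
  by apply/andP; split; lra.
have -> : D = (fun b => D b + g b) - g by apply/funext => b; rewrite /= addrK.
by rewrite deriveB//; [rewrite derive_val | exact: diff_derivable].
Qed.

Variables (Q2 : set 'rV[R]_m) (Lg : R).
Hypotheses (cQ2 : convex_set Q2) (cg : convex_function Q2 g).
Hypothesis (lg : lcg N2 Q2 Lg g).

Lemma lagrangian_le_tangent b : Q2 a -> Q2 b ->
  f w + dot (A w) b - g b <= D a + dot (grad D a) (b - a).
Proof.
move=> Qa Qb; have dg := proj1 lg a Qa.
have := convex_ge_tangent cg Qa Qb dg.
by rewrite grad_dual_obj// dual_obj_w_map !dotE; lra.
Qed.

Lemma dual_obj_le_tangent b : Q2 a -> Q2 b ->
  D b <= D a + dot (grad D a) (b - a).
Proof.
move=> Qa Qb; apply: le_trans (lagrangian_le_tangent Qa Qb).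
by apply: dual_obj_le; case: aw.
Qed.

(** The two curvatures add up: [K] from the inner maximum and [Lg / 2] from the descent lemma for
    [g]. *)
Lemma dual_obj_ge_tangent b : Q2 a -> Q2 b ->
  D a + dot (grad D a) (b - a)
    - lcg_modulus N1 N2 A rho Lg / 2 * N2 (b - a) ^+ 2 <= D b.
Proof.
move=> Qa Qb; have dg := proj1 lg a Qa; have rho0 : 0 < rho by case: hf.
have := lcg_le_quadratic hN2 cQ2 lg Qa Qb; have := dual_obj_ge b.
rewrite grad_dual_obj// dual_obj_w_map /lcg_modulus !dotE.
rewrite (_ : (_ + Lg) / 2 = K + Lg / 2); first lra.
by field; rewrite gt_eqF.
Qed.

End AtPoint.

End DualObjective.

(** * Step sizes and optimality inequalities of the two prox steps *)

Lemma tau_itv (R : realType) (k : nat) : 0 < tau R k <= 1.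
Proof.
rewrite /tau divr_gt0 ?ltr0n ?addnS//= ler_pdivrMr ?ltr0n// mul1r.
by rewrite ler_nat.
Qed.

(** Minimality of [v] compares it with [b]; strong convexity then bounds the Bregman term at [v]
    from below. *)
Lemma bregman_proj_le (R : realType) m (N : 'rV[R]_m -> R) (Q : set 'rV[R]_m)
    (d : 'rV[R]_m -> R) sigma s a G v b :
  strongly_convex N Q sigma d -> Q a -> differentiable d a ->
  is_bregman_proj Q d a (- s *: G) v -> Q b ->
  s * dot G (b - a) - bregman d b a
    <= s * dot G (v - a) - sigma / 2 * N (v - a) ^+ 2.
Proof.
move=> sd Qa dd [Qv vmin] Qb; have := vmin b Qb; rewrite !dotZl.
have := strongly_convex_bregman sd Qa Qv dd; lra.
Qed.

(** First-order optimality of [a], in which only [d] is differentiated and [g] is handled by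
    convexity along the segment from [a] to [b]. *)
Lemma alpha_map_bregman (R : realType) n m (A : {linear 'rV[R]_n -> 'rV[R]_m})
    (g d : 'rV[R]_m -> R) (Q : set 'rV[R]_m) mu w a b :
  convex_set Q -> convex_function Q g -> 0 < mu ->
  is_alpha_map A g Q d mu w a -> differentiable d a -> Q b ->
  dot (A w) b - g b - mu * d b
    <= dot (A w) a - g a - mu * d a - mu * bregman d b a.
Proof.
move=> cQ cg mu0 [Qa amax] dd Qb.
have : mu^-1 * (dot (A w) (b - a) + g a - g b) <= dot (grad d a) (b - a).
  apply: le_dot_grad => // t /andP[t0 t1]; have t01 : 0 <= t <= 1 by rewrite ltW.
  have := amax _ (convex_set_segment cQ Qa Qb t01).
  have := convex_function_segment cg Qa Qb t01.
  rewrite dotDr dotZr => gt Ft; rewrite -lerBrDl mulrCA ler_pdivrMl//.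
  by rewrite mulrBr; lra.
rewrite ler_pdivrMl// /bregman dotBr; lra.
Qed.

(** * The excessive gap invariant along the iteration *)

Section ExcessiveGap.
Context {R : realType} {n m : nat}.
Variables (N1 : 'rV[R]_n -> R) (N2 : 'rV[R]_m -> R).
Variables (Q1 : set 'rV[R]_n) (Q2 : set 'rV[R]_m).
Variables (A : {linear 'rV[R]_n -> 'rV[R]_m}).
Variables (f : 'rV[R]_n -> R) (g d : 'rV[R]_m -> R).
Variables (rho Lg sigma : R) (alpha0 : 'rV[R]_m).
Variables (mu : nat -> R) (w what : nat -> 'rV[R]_n).
Variables (alpha amu ahat atil : nat -> 'rV[R]_m).
Local Notation L := (lcg_modulus N1 N2 A rho Lg).
Local Notation D := (dual_obj A f g Q1).
Hypotheses (hN1 : is_norm N1) (hN2 : is_norm N2).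
Hypotheses (cQ1 : convex_set Q1) (cQ2 : convex_set Q2).
Hypotheses (hf : strongly_convex N1 Q1 rho f).
Hypotheses (cg : convex_function Q2 g) (lg : lcg N2 Q2 Lg g).
Hypotheses (hd : strongly_convex N2 Q2 sigma d).
Hypothesis dd : forall a, Q2 a -> differentiable d a.
Hypotheses (d_alpha0 : is_argmin Q2 d alpha0) (d0 : d alpha0 = 0).
Hypothesis L0 : 0 < L.
Hypothesis run : excessive_gap_run A f g Q1 Q2 d sigma L alpha0
  mu w what alpha amu ahat atil.

(** The product telescopes since [1 - tau R k = (k + 1) / (k + 3)]. *)
Lemma run_mu_eq k : mu k.+1 = 6 * L / (sigma * (k + 2)%:R * (k + 3)%:R).
Proof.
have sigma0 : 0 < sigma by case: hd.
elim: k => [|k ih].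
  by rewrite (run_mu1 run) !add0n; field; rewrite gt_eqF.
rewrite (run_mu run)// ih /tau !addSn !natrD -natr1.
have k0 : 0 <= k%:R :> R by [].
field; rewrite gt_eqF//=; apply/and3P; split; lra.
Qed.

Lemma run_mu_gt0 k : 0 < mu k.+1.
Proof.
have sigma0 : 0 < sigma by case: hd.
by rewrite run_mu_eq divr_gt0 ?mulr_gt0// ltr0n addnS.
Qed.

Lemma tau_mu_ge k :
  L * tau R k.+1 ^+ 2 <= (1 - tau R k.+1) * mu k.+1 * sigma.
Proof.
have sigma0 : 0 < sigma by case: hd.
have k0 : 0 <= k%:R :> R by [].
rewrite run_mu_eq /tau !addSn -natr1 !natrD.
(* Over the common denominator the numerator is [6 * (k + 4) - 4 * (k + 3) = 2 * (k + 6)], times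
   [L]. *)
rewrite -subr_ge0 (_ : _ - _ =
    2 * L * (k%:R + 6) / ((k%:R + 3) * (k%:R + 4) ^+ 2)).
  by rewrite divr_ge0 ?mulr_ge0 ?(ltW L0) ?sqr_ge0 ?addr_ge0.
field; rewrite gt_eqF//=; apply/and3P; split; lra.
Qed.

(* [J_mu(w) <= D(alpha)], where [J_mu] is [J] with [mu * d] subtracted inside
   the maximum; the maximum is unfolded. *)
Definition excessive_gap mu w alpha := forall a, Q2 a ->
  f w + dot (A w) a - g a - mu * d a <= D alpha.

Lemma excessive_gap1 : [/\ Q1 (w 1), Q2 (alpha 1) &
  excessive_gap (mu 1) (w 1) (alpha 1)].
Proof.
have aw := run_w1 run; have [Q0 _] := d_alpha0.
have mu0 := run_mu_gt0 0; have [Qalpha _] := run_alpha1 run.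
split=> // [|a Qa]; first by case: aw.
have := lagrangian_le_tangent hN1 hN2 cQ1 hf aw cg lg Q0 Qa.
have := dual_obj_ge_tangent hN1 hN2 cQ1 hf aw cQ2 lg Q0 Qalpha.
have sigma0 : 0 < sigma by case: hd.
have -> : L = mu 1 * sigma by rewrite (run_mu1 run) divfK// gt_eqF.
have := bregman_proj_le hd Q0 (dd Q0) (run_alpha1 run) Qa.
rewrite -(ler_pM2l mu0) !mulrBr !mulVKf ?gt_eqF//.
(* Together with [d alpha0 = 0] this gives [bregman d a alpha0 <= d a]. *)
have := argmin_dot_grad_ge0 cQ2 d_alpha0 Qa (dd Q0).
rewrite -(pmulr_rge0 _ mu0) /bregman d0; lra.
Qed.

(** The new maximand is at most the average, with weights [1 - t] and [t], of the old one and of the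
    Lagrangian at [what k.+1]; as [mu] shrinks by [1 - t], the prox term goes with the old one
    alone. Both parts are bounded by the tangent of [D] at [ahat k.+1]. *)
Lemma excessive_gapS k : Q1 (w k.+1) -> Q2 (alpha k.+1) ->
  excessive_gap (mu k.+1) (w k.+1) (alpha k.+1) ->
  [/\ Q1 (w k.+2), Q2 (alpha k.+2) &
  excessive_gap (mu k.+2) (w k.+2) (alpha k.+2)].
Proof.
move=> Qw Qalpha gap; have mu0 := run_mu_gt0 k; have tau_mu := tau_mu_ge k.
have mapA := run_amu run (ltn0Sn k); have [Qamu _] := mapA.
have aw := run_what run (ltn0Sn k); have [Qwhat _] := aw.
have proj := run_atil run (ltn0Sn k); have [Qatil _] := proj.
have /andP[t0 t1] := tau_itv R k.+1.
move: (run_ahat run (ltn0Sn k)) (run_w run (ltn0Sn k)).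
move: (run_alpha run (ltn0Sn k)) (run_mu run (ltn0Sn k)).
move: t0 t1 tau_mu proj; set t := tau R k.+1.
move=> t0 t1 tau_mu proj alphaS muS ahatE wS.
have t1' : t < 1 by rewrite /t /tau ltr_pdivrMr ?ltr0n ?addnS// mul1r ltr_nat.
have t01 : 0 <= 1 - t <= 1 by rewrite subr_ge0 t1 lerBlDr lerDl ltW.
(* Puts the updates in the form [s x + (1 - s) y] with [s = 1 - t]. *)
have tE : t = 1 - (1 - t) by rewrite subKr.
have Qahat : Q2 (ahat k.+1).
  by rewrite ahatE {2}tE; exact: convex_setP.
have Qw2 : Q1 (w k.+2) by rewrite wS {2}tE; exact: convex_setP.
have Qalpha2 : Q2 (alpha k.+2) by rewrite alphaS {2}tE; exact: convex_setP.
split=> // a Qa.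
have fw : f (w k.+2) <= (1 - t) * f (w k.+1) + t * f (what k.+1).
  rewrite wS {2 4}tE; have [rho0 sf] := hf.
  apply: le_trans (sf _ _ _ t01 Qw Qwhat) _; rewrite gerBl.
  by apply: mulr_ge0 (sqr_ge0 _); rewrite !mulr_ge0//; lra.
have Dalpha := dual_obj_le_tangent hN1 hN2 cQ1 hf aw cg lg Qahat Qalpha.
have lagr := lagrangian_le_tangent hN1 hN2 cQ1 hf aw cg lg Qahat Qa.
have desc := dual_obj_ge_tangent hN1 hN2 cQ1 hf aw cQ2 lg Qahat Qalpha2.
have := bregman_proj_le hd Qamu (dd Qamu) proj Qa.
have amap := alpha_map_bregman cQ2 cg mu0 mapA (dd Qamu) Qa.
have gapk := gap _ Qamu.
set G := grad D _ in Dalpha lagr desc *.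
(* The common point [alpha k.+1] cancels, so the quadratic term of [desc] acquires the factor
   [t ^+ 2]. *)
have alphaB : alpha k.+2 - ahat k.+1 = t *: (atil k.+1 - amu k.+1).
  by rewrite alphaS ahatE opprD addrACA subrr add0r scalerBr.
move: desc; rewrite alphaB (is_norm_scale hN2) (gtr0_norm t0) dotZr exprMn => desc.
set B := bregman d _ _ in amap *; set r := N2 _ ^+ 2 in desc *.
set mk := mu k.+1 in mu0 muS tau_mu amap gapk *.
have s0 : 0 < (1 - t) * mk by rewrite mulr_gt0// subr_gt0.
have sK X : (1 - t) * mk * (t / ((1 - t) * mk) * X) = t * X.
  by rewrite mulrA [_ * (t / _)]mulrC divfK// gt_eqF.
rewrite -(ler_pM2l s0) [leLHS]mulrBr [leRHS]mulrBr !sK => proj'.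
have quad : L / 2 * (t ^+ 2 * r) <= (1 - t) * mk * (sigma / 2) * r.
  have r0 : 0 <= r by exact: sqr_ge0.
  by have := ler_wpM2r r0 tau_mu; lra.
(* Chains [amap], the induction hypothesis at [amu k.+1], and the tangent bound on
   [D (alpha k.+1)]. *)
have part1 : f (w k.+1) + dot (A (w k.+1)) a - g a - mk * d a <=
    D (ahat k.+1) + dot G (alpha k.+1 - ahat k.+1) - mk * B by lra.
have {part1} part1 := ler_wpM2l (proj1 (andP t01)) part1.
have part2 := ler_wpM2l (ltW t0) lagr.
(* The choice of [ahat] recenters the linear terms at [amu k.+1], the base point of the Bregman
   projection. *)
have GE : (1 - t) * dot G (alpha k.+1 - ahat k.+1) + t * dot G (a - ahat k.+1)
    = t * dot G (a - amu k.+1).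
  by rewrite ahatE !dotE; ring.
have -> : dot (A (w k.+2)) a =
    (1 - t) * dot (A (w k.+1)) a + t * dot (A (what k.+1)) a.
  by rewrite wS linearD !linearZ /= dotDl !dotZl.
rewrite muS; lra.
Qed.

Lemma excessive_gap_iter k : [/\ Q1 (w k.+1), Q2 (alpha k.+1) &
  excessive_gap (mu k.+1) (w k.+1) (alpha k.+1)].
Proof.
elim: k => [|k [Qw Qalpha gap]]; first exact: excessive_gap1.
exact: excessive_gapS.
Qed.

Lemma excessive_gap_primal k : compact Q2 ->
  primal_obj A f g Q2 (w k.+1) - D (alpha k.+1)
    <= mu k.+1 * sup [set d a | a in Q2].
Proof.
move=> kQ2; have [_ _ gap] := excessive_gap_iter k; have [Q0 _] := d_alpha0.
(* Continuity on the compact [Q2] bounds the values of [d], so that their [sup] is an upper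
   bound. *)
have cd : {within Q2, continuous d}.
  apply: continuous_in_subspaceT => a; rewrite inE => /dd.
  exact: differentiable_continuous.
have [b _ dmax] := EVT_max_rV (ex_intro _ _ Q0) kQ2 cd.
rewrite /primal_obj lerBlDr -lerBrDl; apply: ge_sup.
  by exists (dot (A (w k.+1)) alpha0 - g alpha0), alpha0.
move=> _ [a Qa <-]; have := gap a Qa.
suff /(ler_wpM2l (ltW (run_mu_gt0 k))) : d a <= sup [set d a | a in Q2] by lra.
apply: ub_le_sup; last by exists a.
by exists (d b) => _ [c Qc <-]; apply: dmax; rewrite inE.
Qed.

End ExcessiveGap.

Theorem theorem5 (R : realType) (n m : nat)
    (N1 : 'rV[R]_n -> R) (N2 : 'rV[R]_m -> R)
    (Q1 : set 'rV[R]_n) (Q2 : set 'rV[R]_m)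
    (A : {linear 'rV[R]_n -> 'rV[R]_m})
    (f : 'rV[R]_n -> R) (g d : 'rV[R]_m -> R)
    (rho Lg sigma : R) (alpha0 : 'rV[R]_m)
    (mu : nat -> R) (w what : nat -> 'rV[R]_n)
    (alpha amu ahat atil : nat -> 'rV[R]_m)
    (L := lcg_modulus N1 N2 A rho Lg)
    (J := primal_obj A f g Q2) (D := dual_obj A f g Q1)
    (Dmax := sup [set d a | a in Q2])
    (hN1 : is_norm N1) (hN2 : is_norm N2)
    (hQ1 : convex_set Q1) (hQ2 : convex_set Q2) (hQ2c : compact Q2)
    (hf : strongly_convex N1 Q1 rho f)
    (hg : convex_function Q2 g) (hgL : lcg N2 Q2 Lg g)
    (hd : strongly_convex N2 Q2 sigma d)
    (hd_smooth : forall a, Q2 a -> differentiable d a)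
    (halpha0 : is_argmin Q2 d alpha0) (hd_min : d alpha0 = 0)
    (hL : 0 < L)
    (h_strong : inf [set J v | v in Q1] = sup [set D a | a in Q2])
    (h_weak : forall v a, Q1 v -> Q2 a -> D a <= J v)
    (hrun : excessive_gap_run A f g Q1 Q2 d sigma L alpha0
              mu w what alpha amu ahat atil)
    (k : nat) (hk : (1 <= k)%N) :
  J (w k) - D (alpha k)
    <= 6 * L * Dmax / (sigma * (k + 1)%:R * (k + 2)%:R) /\
  6 * L * Dmax / (sigma * (k + 1)%:R * (k + 2)%:R) =
    6 * Dmax / (sigma * (k + 1)%:R * (k + 2)%:R)
      * (op_norm N1 N2 A ^+ 2 / rho + Lg).
Proof.
split; last by rewrite (mulrAC 6) (mulrAC _ L).
case: k hk => // k' _.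
have := excessive_gap_primal hN1 hN2 hQ1 hQ2 hf hg hgL hd hd_smooth halpha0
  hd_min hL hrun k' hQ2c.
(* With [k = k'.+1], the factors [k' + 2] and [k' + 3] of [run_mu_eq] are [k + 1] and [k + 2]. *)
by rewrite (run_mu_eq hd hrun) !addSnnS (mulrAC _ _^-1).
Qed.
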